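(* For all real numbers $a,b>0$, writing $H=H(a,b)$, $G=G(a,b)$, $N_1=N_1(a,b)$, $N_2=N_2(a,b)$, $A=A(a,b)$, $$H\le G\le \frac{G+H+3N_2}{5}\le \frac{G+2N_2}{3}\le N_1\le \frac{2A+7N_1}{9}\le N_2\le \frac{A+N_1}{2}\le \frac{7A+H}{8}\le A.$$
   Context: For $a,b>0$ define the means $H(a,b)=\frac{2ab}{a+b}$, $G(a,b)=\sqrt{ab}$, $N_1(a,b)=\left(\frac{\sqrt a+\sqrt b}{2}\right)^2$, $N_2(a,b)=\left(\frac{\sqrt a+\sqrt b}{2}\right)\sqrt{\frac{a+b}{2}}$, $A(a,b)=\frac{a+b}{2}$. *)

(* Defs.v *)
From Stdlib Require Import Reals.

Open Scope R_scope.

Definition mean_H (a b : R) : R := 2 * a * b / (a + b).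

Definition mean_G (a b : R) : R := sqrt (a * b).

Definition mean_N1 (a b : R) : R := ((sqrt a + sqrt b) / 2) ^ 2.

Definition mean_N2 (a b : R) : R := (sqrt a + sqrt b) / 2 * sqrt ((a + b) / 2).

Definition mean_A (a b : R) : R := (a + b) / 2.

(* Main.v *)
Require Import Defs.
From Stdlib Require Import Reals Lra Psatz.
Open Scope R_scope.

(** Put [s = (sqrt a + sqrt b) / 2] and [q = sqrt ((a + b) / 2)], the
    arithmetic and the quadratic mean of [sqrt a] and [sqrt b].  All five means
    are functions of these two numbers alone:
    [A = q^2], [N1 = s^2], [N2 = s q], [G = 2 s^2 - q^2] and, because
    [H A = G^2], [H = (2 s^2 - q^2)^2 / q^2].  They are homogeneous of degree
    two in [(s, q)], so each inequality is one about polynomials in the single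
    ratio [t = q / s], which ranges over [1 <= t < sqrt 2]: the lower bound is
    [s <= q], the upper one is [G > 0].

    Both ends of each link agree at [t = 1] (the case [a = b]), so [q - s] can be
    factored out, and what remains has a visible sign on that range.  For
    example the link from [N2] to [(A + N1) / 2] is [0 <= (q - s)^2], and the one
    from [(2 A + 7 N1) / 9] to [N2] is [0 <= (q - s) (7 s - 2 q)].  Only two links
    need more about the fraction [H] than [H <= G]; they are cleared of
    denominators in [four_G_le_H_plus_3N2] and [four_N1_le_3A_plus_H]. *)

(** The reduction to two parameters.  The formula for [G] is the identity
    [2 ((x + y) / 2)^2 - (x^2 + y^2) / 2 = x y] at [x = sqrt a], [y = sqrt b];
    [H] is described by [H A = G^2] so as to avoid a quotient. *)
Lemma means_parametrization (a b : R) (ha : 0 < a) (hb : 0 < b) :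
  exists s q : R,
    0 < s /\ s <= q /\ q ^ 2 < 2 * s ^ 2 /\
    mean_A a b = q ^ 2 /\ mean_N1 a b = s ^ 2 /\ mean_N2 a b = s * q /\
    mean_G a b = 2 * s ^ 2 - q ^ 2 /\
    mean_H a b * q ^ 2 = (2 * s ^ 2 - q ^ 2) ^ 2.
Proof.
  exists ((sqrt a + sqrt b) / 2), (sqrt ((a + b) / 2)).
  assert (hx : 0 < sqrt a) by now apply sqrt_lt_R0.
  assert (hy : 0 < sqrt b) by now apply sqrt_lt_R0.
  assert (ex : sqrt a ^ 2 = a) by (apply pow2_sqrt; lra).
  assert (ey : sqrt b ^ 2 = b) by (apply pow2_sqrt; lra).
  assert (eq2 : sqrt ((a + b) / 2) ^ 2 = (a + b) / 2) by (apply pow2_sqrt; lra).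
  assert (hxy : 0 < sqrt a * sqrt b) by now apply Rmult_lt_0_compat.
  assert (eG : 2 * ((sqrt a + sqrt b) / 2) ^ 2 - (a + b) / 2 = sqrt a * sqrt b)
    by (rewrite <- ex at 2; rewrite <- ey at 2; field).
  rewrite eq2.
  repeat split; try reflexivity.
  - lra.
  - apply Rsqr_incr_0_var; [| apply sqrt_pos].
    rewrite !Rsqr_pow2, eq2; pose proof (pow2_ge_0 (sqrt a - sqrt b)); nra.
  - lra.
  - rewrite eG; apply sqrt_mult; lra.
  - rewrite eG, Rpow_mult_distr, ex, ey; unfold mean_H; field; lra.
Qed.

(** Multiplied by [q^2], the difference of the two sides is
    [5 q^4 + 3 s q^3 - 12 s^2 q^2 + 4 s^4], which vanishes at [q = s]; the
    cofactor of [q - s] is a sum of terms that are nonnegative for [s <= q]. *)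
Lemma four_G_le_H_plus_3N2 (s q h : R) (hs : 0 < s) (hsq : s <= q)
    (hh : h * q ^ 2 = (2 * s ^ 2 - q ^ 2) ^ 2) :
  4 * (2 * s ^ 2 - q ^ 2) <= h + 3 * (s * q).
Proof.
  apply Rmult_le_reg_r with (q ^ 2); [apply pow_lt; lra |].
  rewrite Rmult_plus_distr_r, hh.
  assert (0 <= (q - s) *
    (5 * q ^ 3 + 4 * (s * ((q - s) * (q + s))) + 4 * (q * (s * (q - s))))).
  { apply Rmult_le_pos; [lra |].
    assert (0 <= q ^ 3) by (apply pow_le; lra).
    assert (0 <= s * ((q - s) * (q + s)))
      by (repeat apply Rmult_le_pos; lra).
    assert (0 <= q * (s * (q - s))) by (repeat apply Rmult_le_pos; lra).
    lra. }
  lra.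
Qed.

(** Multiplied by [q^2], the difference of the two sides is the square
    [4 (q^2 - s^2)^2]. *)
Lemma four_N1_le_3A_plus_H (s q h : R) (hq : 0 < q)
    (hh : h * q ^ 2 = (2 * s ^ 2 - q ^ 2) ^ 2) :
  4 * s ^ 2 <= 3 * q ^ 2 + h.
Proof.
  apply Rmult_le_reg_r with (q ^ 2); [now apply pow_lt |].
  rewrite (Rmult_plus_distr_r _ h), hh.
  pose proof (pow2_ge_0 (q ^ 2 - s ^ 2)); lra.
Qed.

Lemma H_le_G (g p h : R) (hg : 0 <= g) (hp : 0 < p) (hgp : g <= p)
    (hh : h * p = g ^ 2) :
  h <= g.
Proof.
  apply Rmult_le_reg_r with p; [assumption |].
  rewrite hh; nra.
Qed.

Theorem corollary3p3 (a b : R) (ha : 0 < a) (hb : 0 < b) :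
  let H := mean_H a b in
  let G := mean_G a b in
  let N1 := mean_N1 a b in
  let N2 := mean_N2 a b in
  let A := mean_A a b in
  H <= G /\
  G <= (G + H + 3 * N2) / 5 /\
  (G + H + 3 * N2) / 5 <= (G + 2 * N2) / 3 /\
  (G + 2 * N2) / 3 <= N1 /\
  N1 <= (2 * A + 7 * N1) / 9 /\
  (2 * A + 7 * N1) / 9 <= N2 /\
  N2 <= (A + N1) / 2 /\
  (A + N1) / 2 <= (7 * A + H) / 8 /\
  (7 * A + H) / 8 <= A.
Proof.
  destruct (means_parametrization a b ha hb)
    as (s & q & hs & hsq & hq2 & eA & eN1 & eN2 & eG & hh).
  cbv zeta; rewrite eA, eN1, eN2, eG.
  set (h := mean_H a b) in *.
  assert (N1_le_N2 : s ^ 2 <= s * q) by nra.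
  assert (N2_le_A : s * q <= q ^ 2) by nra.
  assert (hG : h <= 2 * s ^ 2 - q ^ 2) by (apply H_le_G with (q ^ 2); nra).
  pose proof (four_G_le_H_plus_3N2 s q h hs hsq hh).
  assert (4 * s ^ 2 <= 3 * q ^ 2 + h)
    by (apply four_N1_le_3A_plus_H; [lra | assumption]).
  pose proof (pow2_ge_0 (q - s)).
  (* [q^2 < 2 s^2] gives [q < 2 s], which is more than enough here. *)
  assert (0 <= (q - s) * (7 * s - 2 * q)) by (apply Rmult_le_pos; nra).
  repeat split; lra.
Qed.
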